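(* Let $n\ge 0$ be an integer, let $\mathcal{L}=(\mathcal{L}_i)_{i\in\mathbb{N}}$ be a sequence of classes of finite (weighted or unweighted) graphs with $\mathcal{L}_0\subseteq\mathcal{L}_1\subseteq\cdots$, each of asymptotic dimension at most $n$, and let $\mathcal{C}$ be an $\mathcal{L}$-layerable class of finite (weighted or unweighted) graphs. Then $\mathcal{C}$ has asymptotic dimension at most $n+1$. Furthermore, let $a,b,c\ge 1$ and $d\ge 0$ be constants and assume that $\mathcal{C}$ is $c$-linearly $\mathcal{L}$-layerable and that, for every $i$, the class $\mathcal{L}_i$ has an $n$-dimensional control function $D_i$ with $D_i(r)\le ar+bi+d$ for all $r>0$. Then $\mathcal{C}$ has asymptotic dimension at most $n+1$ of linear type. If moreover $d=0$, then $\mathcal{C}$ has Assouad–Nagata dimension at most $n+1$, with an $(n+1)$-dimensional control function $D_{\mathcal C}$ satisfying $D_{\mathcal C}(r)\le 20\big(6(a+2bc)^2+(a+2bc)bc(n+4)\big)\, r$ for all $r>0$.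
   Context: A weighted graph has positive real edge weights and is a metric space on its vertices with the weighted shortest-path distance $d_G$ (infinite between components); unweighted graphs have all weights 1. An induced subgraph $H$ of $G$ inherits the weights and is considered with its own (intrinsic) shortest-path metric $d_H$. A real projection of $G$ is a map $L:V(G)\to\mathbb{R}$ with $|L(x)-L(y)|\le d_G(x,y)$ for all $x,y$. A set $A\subseteq V(G)$ is $(\infty,S)$-bounded with respect to $L$ if $|L(x)-L(y)|\le S$ for all $x,y\in A$. The class $\mathcal{C}$ is $\mathcal{L}$-layerable if there is a function $f:\mathbb{R}^+\to\mathbb{N}$ such that every $G\in\mathcal{C}$ has a real projection $L$ such that for every $S>0$, every $(\infty,S)$-bounded set of $G$ induces a graph in $\mathcal{L}_{f(S)}$; it is $c$-linearly $\mathcal{L}$-layerable if moreover $f(S)\le cS$ for all $S>0$. For a metric space $(X,d)$, a family $\mathcal U$ of subsets is $D$-bounded if every member has diameter at most $D$, and $r$-disjoint if points in different members are at distance $>r$. A function $D:\mathbb{R}^+\to\mathbb{R}^+$ is an $n$-dimensional control function for $X$ (or for a class, if it works for every member) if for every $r>0$ there is a cover $\mathcal U=\mathcal U_1\cup\dots\cup\mathcal U_{n+1}$ of $X$ with each $\mathcal U_i$ $r$-disjoint and each member $D(r)$-bounded. A class has asymptotic dimension at most $n$ if it has an $n$-dimensional control function; of linear type if it has one with $D(r)\le c'r+c'$ for a constant $c'$; and Assouad–Nagata dimension at most $n$ if it has one with $D(r)\le c'r$. *)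

(* Defs.v *)
From Stdlib Require Import Reals.
From Coquelicot Require Import Rbar Lub.
From mathcomp Require Import ssreflect ssrfun ssrbool eqtype ssrnat seq path
  choice fintype finset.

Set Implicit Arguments.
Unset Strict Implicit.
Unset Printing Implicit Defensive.

Local Open Scope R_scope.

(* A finite weighted graph: a finite vertex type, a symmetric irreflexive
   adjacency relation and positive symmetric edge weights.  Unweighted graphs
   are the special case of all weights equal to 1. *)
Record wgraph := WGraph {
  vert : finType;
  adj : rel vert;
  wt : vert -> vert -> R;
  adj_sym : forall x y, adj x y = adj y x;
  adj_irr : forall x, ~~ adj x x;
  wt_sym : forall x y, wt x y = wt y x;
  wt_pos : forall x y, adj x y -> 0 < wt x y
}.

Definition gclass := wgraph -> Prop.

Fixpoint walk_len (G : wgraph) (x : vert G) (p : seq (vert G)) : R :=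
  match p with
  | [::] => 0
  | y :: p' => wt x y + @walk_len G y p'
  end.

(* shortest-path distance d_G (p_infty between different components) *)
Definition dist (G : wgraph) (x y : vert G) : Rbar :=
  Glb_Rbar (fun l => exists p : seq (vert G),
     path (@adj G) x p /\ last x p = y /\ l = @walk_len G x p).

(* induced subgraph on A, with inherited weights (its own intrinsic metric
   is then dist (@induced G A)) *)
Definition induced (G : wgraph) (A : {set vert G}) : wgraph.
Proof.
refine (@WGraph {x : vert G | x \in A}
          (fun u v => adj (val u) (val v))
          (fun u v => wt (val u) (val v)) _ _ _ _).
- by move=> u v; apply: adj_sym.
- by move=> u; apply: adj_irr.
- by move=> u v; apply: wt_sym.
- by move=> u v; apply: wt_pos.
Defined.

Definition real_proj (G : wgraph) (L : vert G -> R) : Prop :=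
  forall x y, Rbar_le (Rbar.Finite (Rabs (L x - L y))) (dist x y).

Definition inf_S_bounded (G : wgraph) (L : vert G -> R) (S : R)
  (A : {set vert G}) : Prop :=
  forall x y, x \in A -> y \in A -> Rabs (L x - L y) <= S.

Definition layerable_with (Lc : nat -> gclass) (C : gclass) (f : R -> nat)
  : Prop :=
  forall G, C G -> exists L : vert G -> R, real_proj L /\
    forall S, 0 < S -> forall A : {set vert G}, inf_S_bounded L S A ->
      Lc (f S) (@induced G A).

Definition layerable (Lc : nat -> gclass) (C : gclass) : Prop :=
  exists f : R -> nat, layerable_with Lc C f.

Definition c_lin_layerable (c : R) (Lc : nat -> gclass) (C : gclass) : Prop :=
  exists f : R -> nat, layerable_with Lc C f /\
    forall S, 0 < S -> INR (f S) <= c * S.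

Definition r_disjoint (G : wgraph) (r : R) (U : {set {set vert G}}) : Prop :=
  forall A B, A \in U -> B \in U -> A != B ->
    forall x y, x \in A -> y \in B -> Rbar_lt (Rbar.Finite r) (dist x y).

Definition D_bounded (G : wgraph) (D : R) (U : {set {set vert G}}) : Prop :=
  forall A, A \in U -> forall x y, x \in A -> y \in A ->
    Rbar_le (dist x y) (Rbar.Finite D).

Definition control_fun (n : nat) (D : R -> R) (G : wgraph) : Prop :=
  (forall r, 0 < r -> 0 < D r) /\
  forall r, 0 < r -> exists U : 'I_n.+1 -> {set {set vert G}},
    (forall x : vert G, exists i, exists A, A \in U i /\ x \in A) /\
    (forall i, r_disjoint r (U i)) /\
    (forall i, D_bounded (D r) (U i)).

Definition control_fun_class (n : nat) (D : R -> R) (C : gclass) : Prop :=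
  forall G, C G -> control_fun n D G.

Definition asdim_le (C : gclass) (n : nat) : Prop :=
  exists D, control_fun_class n D C.

Definition asdim_le_linear (C : gclass) (n : nat) : Prop :=
  exists D c', control_fun_class n D C /\ forall r, 0 < r -> D r <= c' * r + c'.

Definition ANdim_le (C : gclass) (n : nat) : Prop :=
  exists D c', control_fun_class n D C /\ forall r, 0 < r -> D r <= c' * r.

(* Main.v *)
From Stdlib Require Import Reals Lra Lia ZArith ClassicalEpsilon.
From Coquelicot Require Import Rbar Lub.
From mathcomp Require Import ssreflect ssrfun ssrbool eqtype ssrnat seq path
  choice fintype finset.
Require Import Defs.

Set Implicit Arguments.
Unset Strict Implicit.
Unset Printing Implicit Defensive.

Local Open Scope R_scope.

(* Because [L] is 1-Lipschitz, two points of a slab of width [S] that are close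
   in [G] are equally close in the intrinsic metric of a slightly wider slab, so
   every slab is covered by [n + 1] families that are disjoint and bounded for
   the metric of [G]. Cut the line periodically into zones of width [(n + 2) r]
   separated by cores of width [r]. On a zone, Kolmogorov's trick turns [n + 1]
   families that are [3 r]-disjoint into [n + 2] families that are
   [r]-disjoint, [D1]-bounded and cover every point twice; one may then leave
   colour [i] unused on the [i]-th strip of width [r] of each zone and still
   cover everything. On the cores take [n + 1] families that are
   [(3 r + 2 D1)]-disjoint and let each of their members absorb the zone members
   of the same colour at distance at most [r]. The unused strips prevent this
   absorption from propagating from one core to the next, so the resulting
   [n + 2] families are [r]-disjoint and uniformly bounded. *)

(** * Walks, and distance as an infimum of their lengths *)

Section Walks.
Variable G : wgraph.
Implicit Types (x y z : vert G) (p : seq (vert G)).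

Definition is_walk x y (l : R) : Prop :=
  exists p, path (@adj G) x p /\ last x p = y /\ l = walk_len x p.

Lemma walk_len_ge0 x p : path (@adj G) x p -> 0 <= walk_len x p.
Proof.
elim: p x => [|y p IH] x /=; first by move=> _; lra.
by case/andP=> /wt_pos xy /IH ?; lra.
Qed.

Lemma is_walk_refl x : is_walk x x 0.
Proof. by exists [::]. Qed.

Lemma is_walk_edge x y : adj x y -> is_walk x y (wt x y).
Proof. by move=> xy; exists [:: y]; rewrite /= xy; do 2!split=> //; lra. Qed.

Lemma walk_len_cat x p q :
  walk_len x (p ++ q) = walk_len x p + walk_len (last x p) q.
Proof. by elim: p x => [|y p IH] x /=; rewrite ?IH; lra. Qed.

Lemma is_walk_cat x y z l m :
  is_walk x y l -> is_walk y z m -> is_walk x z (l + m).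
Proof.
move=> [p [xp [py ->]]] [q [yq [qz ->]]]; exists (p ++ q).
by rewrite cat_path last_cat walk_len_cat xp py.
Qed.

Lemma is_walk_sym x y l : is_walk x y l -> is_walk y x l.
Proof.
case=> p; elim: p x l => [|z p IH] x l /= [xp [py ->]].
  by rewrite -py; apply: is_walk_refl.
case/andP: xp => xz zp; rewrite Rplus_comm.
apply: (is_walk_cat (IH z (walk_len z p) _)) => //.
by rewrite wt_sym; apply: is_walk_edge; rewrite adj_sym.
Qed.

Definition within (e : R) x y : Prop := Rbar_le (dist x y) (Rbar.Finite e).

(** [dist] is an infimum in [Rbar], so a bound by [e] amounts to walks shorter than each [e' > e].
    This needs no shortest walk and covers infinite distance as well. *)
Lemma withinP e x y :
  within e x y <-> forall e', e < e' -> exists l, is_walk x y l /\ l < e'.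
Proof.
rewrite /within /dist -/(is_walk x y).
have [lb glb] := Glb_Rbar_correct (is_walk x y); split=> [le_e e' lt_e|H].
  apply: NNPP => no; apply: (Rbar_lt_not_le (Rbar.Finite e') (Rbar.Finite e)) => //.
  apply: Rbar_le_trans le_e; apply: glb => l wl /=.
  by apply: Rnot_lt_le => lt_l; apply: no; exists l.
apply: Rbar_not_lt_le => lt_e.
have [e' lt1 lt2] : exists2 e', e < e' & Rbar_lt (Rbar.Finite e') (Glb_Rbar (is_walk x y)).
  case: (Glb_Rbar _) lt_e => [g||] //= lt_e.
    by exists ((e + g) / 2); lra.
  by exists (e + 1) => //; lra.
have [l [/lb le_l lt_l]] := H _ lt1.
by have := Rbar_lt_le_trans _ _ _ lt2 le_l => /= ?; lra.
Qed.

Lemma not_within e x y : ~ within e x y <-> Rbar_lt (Rbar.Finite e) (dist x y).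
Proof.
split; first by apply: Rbar_not_le_lt.
by apply: Rbar_lt_not_le.
Qed.

Lemma within_refl e x : 0 <= e -> within e x x.
Proof.
move=> e0; apply/withinP => e' lt_e; exists 0; split; last lra.
exact: is_walk_refl.
Qed.

Lemma within_sym e x y : within e x y -> within e y x.
Proof.
move/withinP=> H; apply/withinP => e' /H [l [wl lt_l]].
by exists l; split=> //; apply: is_walk_sym.
Qed.

Lemma within_trans e1 e2 x y z :
  within e1 x y -> within e2 y z -> within (e1 + e2) x z.
Proof.
move=> /withinP H1 /withinP H2; apply/withinP => e' lt_e.
have [|l [wl lt_l]] := H1 (e1 + (e' - (e1 + e2)) / 2); first lra.
have [|m [wm lt_m]] := H2 (e2 + (e' - (e1 + e2)) / 2); first lra.
exists (l + m); split; last lra.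
exact: is_walk_cat wl wm.
Qed.

Lemma within_le e1 e2 x y : e1 <= e2 -> within e1 x y -> within e2 x y.
Proof. by move=> le12 w1; apply: Rbar_le_trans w1 _. Qed.

Lemma real_proj_within (L : vert G -> R) e x y :
  real_proj L -> within e x y -> Rabs (L x - L y) <= e.
Proof. by move=> pL; apply: Rbar_le_trans (pL x y). Qed.

Lemma real_proj_edge (L : vert G -> R) x y :
  real_proj L -> adj x y -> Rabs (L x - L y) <= wt x y.
Proof.
move=> pL xy; apply: real_proj_within => //; apply/withinP => e' lt_e.
by exists (wt x y); split=> //; apply: is_walk_edge.
Qed.

End Walks.

(** * Intrinsic versus ambient distance in an induced subgraph *)

Section Induced.
Variables (G : wgraph) (A : {set vert G}).

Lemma induced_walk_val (u v : vert (induced A)) l :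
  @is_walk (induced A) u v l ->
  exists p, path (@adj G) (val u) p /\ last (val u) p = val v /\
    l = walk_len (val u) p.
Proof.
case=> p; elim: p u l => [|w p IH] u l /= [up [pv ->]].
  by exists [::]; rewrite -pv.
case/andP: up => uw wp.
have [//|q [wq [qv ->]]] := IH w (walk_len w p).
by exists (val w :: q) => /=; rewrite uw.
Qed.

Lemma induced_within e (u v : vert (induced A)) :
  @within (induced A) e u v -> within e (val u) (val v).
Proof.
move/withinP=> H; apply/withinP=> e' /H [l [/induced_walk_val wl lt_l]].
by exists l.
Qed.

(** Each edge moves [L] by at most its weight, so no vertex of the walk leaves the band of
    half-width [walk_len (val u) p] around [L (val u)], which lies in [A]. *)
Lemma induced_lift_walk (L : vert G -> R) (u : vert (induced A)) p :
  real_proj L -> path (@adj G) (val u) p ->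
  (forall z, Rabs (L z - L (val u)) <= walk_len (val u) p -> z \in A) ->
  exists q : seq (vert (induced A)),
    path (@adj (induced A)) u q /\ val (last u q) = last (val u) p /\
    walk_len u q = walk_len (val u) p.
Proof.
move=> pL; elim: p u => [|y p IH] u /=; first by exists [::].
case/andP=> uy yp inA.
have Luy := real_proj_edge pL uy; have yp0 := walk_len_ge0 yp.
have yA : y \in A by apply: inA; rewrite Rabs_minus_sym; lra.
have [//|z Lz|q [yq [qv qlen]]] := IH (Sub y yA : vert (induced A)).
  apply: inA; move: Lz => /= Lz.
  have := Rabs_triang (L z - L y) (L y - L (val u)).
  have -> : L z - L y + (L y - L (val u)) = L z - L (val u) by ring.
  by rewrite (Rabs_minus_sym (L y)) /=; lra.
exists ((Sub y yA : vert (induced A)) :: q) => /=.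
by rewrite uy yq; do 2!split=> //; rewrite qlen.
Qed.

Lemma within_induced (L : vert G -> R) e e' (u v : vert (induced A)) :
  real_proj L -> e < e' ->
  (forall z, Rabs (L z - L (val u)) <= e' -> z \in A) ->
  within e (val u) (val v) -> @within (induced A) e u v.
Proof.
move=> pL lt_e inA /withinP H; apply/withinP=> e1 lt_e1.
(* Length below [e1] is what [withinP] asks for; length below [e'] keeps the walk in [A]. *)
have [|l [[p [up [pv ->]]] lt_l]] := H (Rmin e1 e'); first exact: Rmin_glb_lt.
have [le1 le2] := (Rmin_l e1 e', Rmin_r e1 e').
have [z Lz|q [uq [qv qlen]]] := @induced_lift_walk L u p pL up.
  by apply: inA; lra.
exists (walk_len u q); split; last by rewrite qlen; lra.
by exists q; do 2!split=> //; apply: val_inj; rewrite qv.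
Qed.

End Induced.

(** * Classical decision and choice *)

Definition decide (P : Prop) : bool :=
  if excluded_middle_informative P then true else false.

Lemma decideP P : reflect P (decide P).
Proof.
by rewrite /decide; case: excluded_middle_informative => H; constructor.
Qed.

Lemma functional_choice (A B : Type) (Q : A -> B -> Prop) :
  (forall x, exists y, Q x y) -> exists g, forall x, Q x (g x).
Proof.
move=> H; exists (fun x => proj1_sig (constructive_indefinite_description _ (H x))).
by move=> x; apply: proj2_sig.
Qed.

(** * Labelled families and their conversion to sets of sets *)

Section Families.
Variable G : wgraph.

(* [F x t] means that [x] lies in the member of the family labelled [t]. *)
Definition family (T : Type) := vert G -> T -> Prop.

Definition disjoint_fam T (r : R) (F : family T) : Prop :=
  forall x y s t, F x s -> F y t -> within r x y -> s = t.

Definition bounded_fam T (D : R) (F : family T) : Prop :=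
  forall x y t, F x t -> F y t -> within D x y.

(** Labels ease gluing and are forgotten only here. Distinct members have distinct labels, so
    disjointness survives. *)
Definition set_family T (F : family T) : {set {set vert G}} :=
  [set A : {set vert G} | decide (exists t, forall x, x \in A <-> F x t)].

Lemma set_family_cover T (F : family T) x t :
  F x t -> exists A, A \in set_family F /\ x \in A.
Proof.
move=> Fxt; exists [set y | decide (F y t)]; rewrite !inE; split; last exact/decideP.
by apply/decideP; exists t => y; rewrite inE; split=> /decideP.
Qed.

Lemma set_family_disjoint T r (F : family T) :
  disjoint_fam r F -> r_disjoint r (set_family F).
Proof.
move=> dF A B; rewrite !inE => /decideP [s As] /decideP [t Bt] neAB x y xA yB.
apply/not_within => wxy; case/eqP: neAB.
have est : s = t by apply: dF wxy; [apply/As | apply/Bt].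
apply/setP=> z; rewrite -{}est in Bt.
by apply/idP/idP => [/As /Bt|/Bt /As].
Qed.

Lemma set_family_bounded T D (F : family T) :
  bounded_fam D F -> D_bounded D (set_family F).
Proof.
move=> bF A; rewrite inE => /decideP [t At] x y /At xt /At yt.
exact: bF xt yt.
Qed.

(** * Saturated union of a fine and a coarse family *)

Section SaturatedUnion.
Variables (T1 T2 : Type) (Z : family T1) (Y : family T2) (r D1 R D2 : R).
Hypotheses (r_ge0 : 0 <= r) (D1_ge0 : 0 <= D1) (D2_ge0 : 0 <= D2).
Hypotheses (disjZ : disjoint_fam r Z) (bdZ : bounded_fam D1 Z).
Hypotheses (disjY : disjoint_fam R Y) (bdY : bounded_fam D2 Y).
Hypothesis R_large : 3 * r + 2 * D1 <= R.

Definition touches t s : Prop := exists z y, Z z t /\ Y y s /\ within r z y.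

(* Every member of [Y] absorbs the members of [Z] at distance at most [r]. *)
Definition sat_union : family (T2 + T1) := fun x l =>
  match l with
  | inl s => Y x s \/ exists t, Z x t /\ touches t s
  | inr t => Z x t /\ forall s, ~ touches t s
  end.

Lemma sat_union_coverZ x t : Z x t -> exists l, sat_union x l.
Proof.
move=> Zx; case: (classic (exists s, touches t s)) => [[s ts]|no].
  by exists (inl s); right; exists t.
by exists (inr t); split=> // s ts; apply: no; exists s.
Qed.

Lemma sat_union_coverY x s : Y x s -> exists l, sat_union x l.
Proof. by move=> Yx; exists (inl s); left. Qed.

Lemma sat_union_sub x l :
  sat_union x l -> (exists t, Z x t) \/ (exists s, Y x s).
Proof.
case: l => [s [Yx|[t [Zx _]]]|t [Zx _]] /=; first by right; exists s.
  by left; exists t.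
by left; exists t.
Qed.

Lemma sat_union_core x s :
  sat_union x (inl s) -> exists y, Y y s /\ within (D1 + r) x y.
Proof.
case=> [Yx|[t [Zx [z [y [Zz [Yy wzy]]]]]]].
  by exists x; split=> //; apply: within_refl; lra.
by exists y; split=> //; apply: within_trans wzy; apply: bdZ Zx Zz.
Qed.

(** The member [t] of [Z] would either touch [s] directly or, by disjointness of [Z], be one of the
    members that [s] absorbs. *)
Lemma sat_union_disjoint_mixed x y s t :
  sat_union x (inl s) -> sat_union y (inr t) -> within r x y -> False.
Proof.
case=> [Yx|[t' [Zx ts]]] [Zy no] wxy.
  by apply: (no s); exists y, x; do 2!split=> //; apply: within_sym.
by apply: (no s); rewrite -(disjZ Zx Zy wxy).
Qed.

Lemma sat_union_disjoint : disjoint_fam r sat_union.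
Proof.
move=> x y [s|t] [s'|t'] Fx Fy wxy.
- have [x' [Yx wx]] := sat_union_core Fx; have [y' [Yy wy]] := sat_union_core Fy.
  congr inl; apply: disjY Yx Yy _.
  (* The chain from [x'] to [y'] has length [2 * (D1 + r) + r], at most [R] by [R_large]. *)
  have w := within_trans (within_trans (within_sym wx) wxy) wy.
  by apply: within_le w; lra.
- by case: (sat_union_disjoint_mixed Fx Fy wxy).
- by case: (sat_union_disjoint_mixed Fy Fx (within_sym wxy)).
- case: Fx Fy => Zx _ [Zy _]; congr inr; exact: disjZ Zx Zy wxy.
Qed.

Lemma sat_union_bounded : bounded_fam (D2 + 2 * (r + D1)) sat_union.
Proof.
move=> x y [s|t] Fx Fy.
  have [x' [Yx wx]] := sat_union_core Fx; have [y' [Yy wy]] := sat_union_core Fy.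
  have w := within_trans (within_trans wx (bdY Yx Yy)) (within_sym wy).
  by apply: within_le w; lra.
case: Fx Fy => Zx _ [Zy _]; apply: (@within_le _ D1); first lra.
exact: bdZ Zx Zy.
Qed.

End SaturatedUnion.

(** * Kolmogorov's trick: one more colour, and every point covered twice *)

Section Kolmogorov.
Variables (n : nat) (T : Type) (P : 'I_n.+1 -> family T) (r D : R).
Hypotheses (r_ge0 : 0 <= r).
Hypothesis disjP : forall i, disjoint_fam (3 * r) (P i).
Hypothesis bdP : forall i, bounded_fam D (P i).

Definition thicken i : family T := fun x t => exists y, P i y t /\ within r x y.

(* The extra colour collects the points that meet the thickening of a single
   colour only. *)
Definition kolmogorov (i : 'I_n.+2) : family ('I_n.+1 * T) := fun x l =>
  if unlift ord_max i is Some j then l.1 = j /\ thicken j x l.2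
  else P l.1 x l.2 /\ forall j s, j <> l.1 -> ~ thicken j x s.

Lemma kolmogorov_disjoint i : disjoint_fam r (kolmogorov i).
Proof.
rewrite /kolmogorov => x y [j1 s] [j2 t].
case: unliftP => [j _|_] /= [H1 H2] [H3 H4] wxy.
  case: H2 H4 => x' [Px wx] [y' [Py wy]].
  have w := within_trans (within_trans (within_sym wx) wxy) wy.
  rewrite H1 H3; congr pair; apply: (disjP Px Py).
  by apply: within_le w; lra.
(* Since [x] is in [P j1] and near [y], the point [y] is in the thickening of colour [j1]; the extra
   colour excludes every thickening but that of [j2]. *)
have ej : j1 = j2.
  case: (classic (j1 = j2)) => // ne.
  by case: (H4 j1 s ne); exists x; split=> //; apply: within_sym.
rewrite -{}ej in H3 H4 *; congr pair; apply: (disjP H1 H3).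
by apply: within_le wxy; lra.
Qed.

Lemma kolmogorov_bounded i : bounded_fam (D + 2 * r) (kolmogorov i).
Proof.
rewrite /kolmogorov => x y [j1 t].
case: unliftP => [j _|_] /= [H1 H2] [H3 H4].
  case: H2 H4 => x' [Px wx] [y' [Py wy]].
  have w := within_trans (within_trans wx (bdP Px Py)) (within_sym wy).
  by apply: within_le w; lra.
by apply: within_le (bdP H1 H3); lra.
Qed.

(** A point of colour [j] either meets the thickening of a second colour or has the extra colour
    besides [j]. So one forbidden colour [i0] can always be avoided. *)
Lemma kolmogorov_cover_twice x i0 :
  (exists j t, P j x t) -> exists i l, i <> i0 /\ kolmogorov i x l.
Proof.
case=> j [t Px].
have lifted k s : thicken k x s -> kolmogorov (lift ord_max k) x (k, s).
  by rewrite /kolmogorov liftK.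
have thick_j : thicken j x t by exists x; split=> //; apply: within_refl.
case: (classic (lift ord_max j = i0)) => [ei0|ne]; last first.
  by exists (lift ord_max j), (j, t); split=> //; apply: lifted.
case: (classic (exists k s, k <> j /\ thicken k x s)) => [[k [s [nekj th]]]|no].
  exists (lift ord_max k), (k, s); split; last exact: lifted.
  by rewrite -ei0 => /lift_inj.
exists ord_max, (j, t); split.
  by rewrite -ei0 => e; have := neq_lift ord_max j; rewrite -e eqxx.
rewrite /kolmogorov unlift_none; split=> // k s nek th.
by apply: no; exists k, s.
Qed.

End Kolmogorov.

(** The control function is applied to the slab widened by [rho + e] on each side, of width [S]. The
    slack [e] makes up for [rho] being only an infimum of walk lengths. *)
Lemma layer_family (L : vert G -> R) n D lo hi rho e S :
  real_proj L -> 0 < rho -> 0 < e -> hi - lo + 2 * (rho + e) = S ->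
  (forall A, inf_S_bounded L S A -> control_fun n D (induced A)) ->
  exists P : 'I_n.+1 -> family {set vert G},
    (forall i, disjoint_fam rho (P i)) /\
    (forall i, bounded_fam (D rho) (P i)) /\
    (forall x, lo <= L x <= hi -> exists i t, P i x t).
Proof.
move=> pL rho0 e0 eS ctrl.
pose A := [set z | decide (lo - (rho + e) <= L z <= hi + (rho + e))].
have inA z : z \in A <-> lo - (rho + e) <= L z <= hi + (rho + e).
  by rewrite inE; split=> /decideP.
have [x y /inA Lx /inA Ly|_ /(_ rho rho0) [U [covU [disjU bdU]]]] := ctrl A.
  by rewrite /Rabs; case: Rcase_abs; lra.
(* Only points of the inner slab are kept, where intrinsic disjointness gives ambient disjointness.
   Labels are images in [G], so their type does not depend on the slab. *)
exists (fun i x B => lo <= L x <= hi /\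
  exists (W : {set vert (induced A)}) u,
    W \in U i /\ u \in W /\ val u = x /\ B = [set val v | v in W]).
split=> [i|].
  move=> x y s t [Lx [W [u [WU [uW [ux ->]]]]]] [Ly [W' [v [WU' [vW [vy ->]]]]]] wxy.
  case: (eqVneq W W') => [-> //|neW].
  have /not_within := disjU i _ _ WU WU' neW _ _ uW vW; case.
  apply: (within_induced (L := L) (e' := rho + e)) => //; first lra.
    move=> z; rewrite ux => Lz; apply/inA; move: Lz.
    by rewrite /Rabs; case: Rcase_abs; lra.
  by rewrite ux vy.
split=> [i|x Lx].
  move=> x y t [_ [W [u [WU [uW [ux ->]]]]]] [_ [W' [v [WU' [vW [vy eqW]]]]]].
  have eWW : W = W' by apply: (imset_inj val_inj).
  rewrite -ux -vy; apply: induced_within; apply: bdU WU _ _ uW _.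
  by rewrite eWW.
have xA : x \in A by apply/inA; lra.
have [i [W [WU uW]]] := covU (Sub x xA : vert (induced A)).
exists i, [set val v | v in W]; split=> //.
by exists W, (Sub x xA : vert (induced A)).
Qed.

End Families.

(** * Gluing zones and cores along the line *)

(* Cells have length [r]; a period consists of [n + 2] zone cells followed by
   one core cell. *)
Section Assembly.
Variables (G : wgraph) (n : nat) (L : vert G -> R) (r D1 R D2 : R).
Hypotheses (pL : real_proj L) (r_gt0 : 0 < r).
Hypotheses (D1_ge0 : 0 <= D1) (D2_ge0 : 0 <= D2).
Hypothesis R_large : 3 * r + 2 * D1 <= R.

Definition cell (x : vert G) : Z := Int_part (L x / r).

Definition width : Z := Z.of_nat n + 2.

Definition period : Z := Z.of_nat n + 3.

Lemma cell_bounds x : IZR (cell x) * r <= L x < (IZR (cell x) + 1) * r.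
Proof.
have [le1 lt1] := base_Int_part (L x / r); rewrite -/(cell x) in le1 lt1.
have e : L x = L x / r * r by field; lra.
rewrite {1 2}e; split; first by apply: Rmult_le_compat_r => //; lra.
by apply: Rmult_lt_compat_r => //; lra.
Qed.

Lemma within_cell x y : within r x y -> (cell x <= cell y + 1)%Z.
Proof.
move=> /(real_proj_within pL) Lxy.
have [[x1 x2] [y1 y2]] := (cell_bounds x, cell_bounds y).
apply: Znot_gt_le => gt_c.
have : IZR (cell y) + 2 <= IZR (cell x) by rewrite -plus_IZR; apply: IZR_le; lia.
move/(Rmult_le_compat_r r _ _ (Rlt_le _ _ r_gt0)).
by move: Lxy; rewrite /Rabs; case: Rcase_abs; lra.
Qed.

Lemma within_cell2 x y :
  within r x y -> (cell x <= cell y + 1)%Z /\ (cell y <= cell x + 1)%Z.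
Proof. by move=> w; split; apply: within_cell => //; apply: within_sym. Qed.

Definition in_zone (m : Z) x : Prop :=
  (m * period <= cell x < m * period + width)%Z.

Definition in_core (m : Z) x : Prop := (cell x = m * period + width)%Z.

(** The cells strictly between two consecutive strips left free by colour [i]; they contain core
    [b]. Different blocks of one colour are a whole cell apart. *)
Definition in_block (i : 'I_n.+2) (b : Z) x : Prop :=
  (b * period + Z.of_nat i < cell x < (b + 1) * period + Z.of_nat i)%Z.

Lemma in_zone_disjoint m m' x y :
  in_zone m x -> in_zone m' y -> within r x y -> m = m'.
Proof.
rewrite /in_zone /width /period => zx zy /within_cell2 [c1 c2].
case: (Z.lt_trichotomy m m') => [lt|[//|lt]]; nia.
Qed.

Lemma in_block_disjoint i b b' x y :
  in_block i b x -> in_block i b' y -> within r x y -> b = b'.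
Proof.
rewrite /in_block /period => zx zy /within_cell2 [c1 c2].
case: (Z.lt_trichotomy b b') => [lt|[//|lt]]; nia.
Qed.

Lemma ord_colour_bound (i : 'I_n.+2) : (0 <= Z.of_nat i < width)%Z.
Proof. by have /ltP := ltn_ord i; rewrite /width; lia. Qed.

Lemma in_core_block i b x : in_core b x -> in_block i b x.
Proof.
by have := ord_colour_bound i; rewrite /in_core /in_block /width /period; lia.
Qed.

(** Strip [i0] comes after the free strip of colour [i] if [i < i0], hence block [m], and before it
    if [i > i0], hence block [m - 1]. *)
Lemma in_zone_block m (i i0 : 'I_n.+2) x :
  in_zone m x -> (cell x = m * period + Z.of_nat i0)%Z -> i <> i0 ->
  exists b, in_block i b x.
Proof.
move=> zx cx ne.
have nei : nat_of_ord i <> nat_of_ord i0 by move=> /ord_inj.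
have := ord_colour_bound i; have := ord_colour_bound i0.
rewrite /in_block; case: (Z.lt_total (Z.of_nat i) (Z.of_nat i0)) => [lt|[eq|lt]] b1 b2.
- by exists m; move: b1 b2; rewrite cx /width /period; lia.
- by case: nei; lia.
- by exists (m - 1)%Z; move: b1 b2; rewrite cx /width /period; lia.
Qed.

Lemma zone_or_core x :
  exists m, in_core m x \/
    in_zone m x /\ exists i0 : 'I_n.+2, (cell x = m * period + Z.of_nat i0)%Z.
Proof.
have p0 : (0 < period)%Z by rewrite /period; lia.
have e := Z.div_mod (cell x) period; have b := Z.mod_pos_bound (cell x) period p0.
exists (cell x / period)%Z; rewrite /in_core /in_zone.
case: (Z.eq_dec (cell x mod period) width) => [ew|new]; first by left; lia.
right; have bw : (0 <= cell x mod period < width)%Z by move: b new; rewrite /width /period; lia.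
split; first by lia.
have lt : (Z.to_nat (cell x mod period) < n.+2)%N by apply/ltP; move: bw; rewrite /width; lia.
by exists (Ordinal lt) => /=; lia.
Qed.

Variables (T1 T2 : Type).
Variables (Q : Z -> 'I_n.+2 -> family G T1) (P : Z -> 'I_n.+1 -> family G T2).
Hypothesis disjQ : forall m i, disjoint_fam r (Q m i).
Hypothesis bdQ : forall m i, bounded_fam D1 (Q m i).
Hypothesis covQ : forall m x i0, in_zone m x ->
  exists i l, i <> i0 /\ Q m i x l.
Hypothesis disjP : forall m i, disjoint_fam R (P m i).
Hypothesis bdP : forall m i, bounded_fam D2 (P m i).
Hypothesis covP : forall m x, in_core m x -> exists i l, P m i x l.

(** A block can meet zones [b] and [b + 1], so the label records the zone too. *)
Definition zone_fam i b : family G (Z * T1) := fun x l =>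
  in_block i b x /\ in_zone l.1 x /\ Q l.1 i x l.2.

(** The [n + 1] core colours are embedded by [lift ord_max]; colour [ord_max] gets the empty
    family. *)
Definition core_fam i b : family G T2 := fun x t =>
  in_core b x /\ exists j, lift ord_max j = i /\ P b j x t.

Definition assembled i : family G (Z * (T2 + (Z * T1))) := fun x l =>
  sat_union (zone_fam i l.1) (core_fam i l.1) r x l.2.

Lemma zone_fam_disjoint i b : disjoint_fam r (zone_fam i b).
Proof.
move=> x y [m s] [m' t] [_ /= [zx Qx]] [_ /= [zy Qy]] w.
have e := in_zone_disjoint zx zy w; rewrite -{}e in zy Qy *.
by rewrite (disjQ Qx Qy w).
Qed.

Lemma zone_fam_bounded i b : bounded_fam D1 (zone_fam i b).
Proof. by move=> x y [m s] [_ [_ Qx]] [_ [_ Qy]]; apply: bdQ Qx Qy. Qed.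

Lemma core_fam_disjoint i b : disjoint_fam R (core_fam i b).
Proof.
move=> x y s t [_ [j [ji Px]]] [_ [j' [j'i Py]]] w.
have e : j = j' by apply: (@lift_inj _ ord_max); rewrite ji.
by rewrite -{}e in Py; apply: disjP Px Py w.
Qed.

Lemma core_fam_bounded i b : bounded_fam D2 (core_fam i b).
Proof.
move=> x y t [_ [j [ji Px]]] [_ [j' [j'i Py]]].
have e : j = j' by apply: (@lift_inj _ ord_max); rewrite ji.
by rewrite -{}e in Py; apply: bdP Px Py.
Qed.

Lemma assembled_block i x l : assembled i x l -> in_block i l.1 x.
Proof.
by move/sat_union_sub => [[t []]|[s [/in_core_block]]].
Qed.

(** Points within [r] share a block because of the free strips; inside one block the saturated union
    is disjoint. *)
Lemma assembled_disjoint i : disjoint_fam r (assembled i).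
Proof.
move=> x y [b s] [b' t] Fx Fy w.
have e := in_block_disjoint (assembled_block Fx) (assembled_block Fy) w.
rewrite /= in e; rewrite -{}e in Fy *; congr pair.
apply: (sat_union_disjoint _ _ (@zone_fam_disjoint i b)
  (@zone_fam_bounded i b) (@core_fam_disjoint i b) R_large Fx Fy w) => //.
exact: Rlt_le.
Qed.

Lemma assembled_bounded i : bounded_fam (D2 + 2 * (r + D1)) (assembled i).
Proof.
move=> x y [b t] Fx Fy.
apply: (sat_union_bounded _ _ _ (@zone_fam_bounded i b)
  (@core_fam_bounded i b) Fx Fy) => //.
exact: Rlt_le.
Qed.

Lemma assembled_cover x : exists i l, assembled i x l.
Proof.
have [m [cx|[zx [i0 cx]]]] := zone_or_core x.
  have [j [t Px]] := covP cx.
  have Yx : core_fam (lift ord_max j) m x t by split=> //; exists j.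
  have [l Fx] := sat_union_coverY (zone_fam (lift ord_max j) m) r Yx.
  by exists (lift ord_max j), (m, l).
have [i [t [ne Qx]]] := covQ i0 zx.
have [b bx] := in_zone_block zx cx ne.
have Zx : zone_fam i b x (m, t) by [].
have [l Fx] := sat_union_coverZ (core_fam i b) r Zx.
by exists i, (b, l).
Qed.

End Assembly.

(** * The explicit control function and its linear bound *)

Section LayeredControl.
Variables (n : nat) (D : nat -> R -> R) (f : R -> nat).

(** The width is [(n + 2) * r] plus margins [2 * (3 * r + r)]; the final [2 * r] is the cost of
    thickening. *)
Definition zone_bound (r : R) : R :=
  D (f ((INR n + 10) * r)) (3 * r) + 2 * r.

(** The least [R] allowed by [R_large] when [D1] is [zone_bound r]. *)
Definition core_scale (r : R) : R := 3 * r + 2 * zone_bound r.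

(** A core of width [r] with margins [core_scale r + r] has width [2 * core_scale r + 3 * r]; the
    last summand is the cost of saturation. *)
Definition layered_control (r : R) : R :=
  D (f (2 * core_scale r + 3 * r)) (core_scale r) + 2 * (r + zone_bound r).

Lemma layered_control_fun (G : wgraph) (L : vert G -> R) :
  real_proj L ->
  (forall S, 0 < S -> forall A, inf_S_bounded L S A ->
     control_fun n (D (f S)) (induced A)) ->
  control_fun n.+1 layered_control G.
Proof.
move=> pL ctrl.
have D_gt0 S rho : 0 < S -> 0 < rho -> 0 < D (f S) rho.
  (* The empty set is bounded for every [S], and its induced graph already yields positivity. *)
  move=> S0; have [x y|pos _] := ctrl S S0 set0; last exact: pos.
  by rewrite inE.
have n_ge0 := pos_INR n.
have zone_gt0 r : 0 < r -> 0 < zone_bound r.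
  move=> r0; have S0 : 0 < (INR n + 10) * r by nra.
  have : 0 < D (f ((INR n + 10) * r)) (3 * r) by apply: D_gt0 => //; lra.
  by rewrite /zone_bound; lra.
have core_gt0 r : 0 < r -> 0 < D (f (2 * core_scale r + 3 * r)) (core_scale r).
  by move=> r0; have z0 := zone_gt0 r r0; apply: D_gt0; rewrite /core_scale; lra.
split=> [r r0|r r0].
  by have := core_gt0 r r0; have := zone_gt0 r r0; rewrite /layered_control; lra.
have r_ge0 := Rlt_le _ _ r0.
have [z0 c0] := (zone_gt0 r r0, core_gt0 r r0).
have zones m : exists Q : 'I_n.+2 -> family G ('I_n.+1 * {set vert G}),
    (forall i, disjoint_fam r (Q i)) /\
    (forall i, bounded_fam (zone_bound r) (Q i)) /\
    (forall x i0, in_zone n L r m x -> exists i l, i <> i0 /\ Q i x l).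
  have S0 : 0 < (INR n + 10) * r by nra.
  pose lo := IZR (m * period n) * r.
  have [||| P [dP [bP cP]]] := @layer_family G L n _ lo (lo + (INR n + 2) * r)
    (3 * r) r _ pL _ _ _ (ctrl _ S0); [lra | lra | by ring |].
  exists (kolmogorov P r); split; first by move=> i; apply: kolmogorov_disjoint.
  split=> [i|x i0 [zx1 zx2]]; first exact: kolmogorov_bounded.
  apply: kolmogorov_cover_twice => //; apply: cP.
  have [c1 c2] := cell_bounds L r0 x.
  have /IZR_le := zx1; have /IZR_le : (cell L r x + 1 <= m * period n + width n)%Z by lia.
  rewrite plus_IZR [IZR (_ + width n)]plus_IZR /width plus_IZR -INR_IZR_INZ.
  move=> /(Rmult_le_compat_r r _ _ r_ge0) h1 /(Rmult_le_compat_r r _ _ r_ge0) h2.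
  by rewrite /lo; lra.
have cores m : exists P : 'I_n.+1 -> family G {set vert G},
    (forall i, disjoint_fam (core_scale r) (P i)) /\
    (forall i, bounded_fam (D (f (2 * core_scale r + 3 * r)) (core_scale r)) (P i)) /\
    (forall x, in_core n L r m x -> exists i l, P i x l).
  have S0 : 0 < 2 * core_scale r + 3 * r by rewrite /core_scale; lra.
  pose lo := IZR (m * period n + width n) * r.
  have [||| P [dP [bP cP]]] := @layer_family G L n _ lo (lo + r)
    (core_scale r) r _ pL _ _ _ (ctrl _ S0);
    [by rewrite /core_scale; lra | lra | by ring |].
  exists P; do 2!split=> //; move=> x cx; apply: cP.
  by have := cell_bounds L r0 x; rewrite cx /lo; lra.
(* Families are chosen for all integers [m] at once. *)
have [Q /all_and2 [dQ /all_and2 [bQ cQ]]] := functional_choice zones.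
have [P /all_and2 [dP /all_and2 [bP cP]]] := functional_choice cores.
exists (fun i => set_family (@assembled G n L r _ _ Q P i)); split=> [x|].
  have [i [l Fx]] := assembled_cover cQ cP x.
  by exists i; apply: set_family_cover Fx.
have z_ge0 := Rlt_le _ _ z0; have c_ge0 := Rlt_le _ _ c0.
split=> i.
  apply: set_family_disjoint.
  exact: (assembled_disjoint pL r0 z_ge0 (Rle_refl _) dQ bQ dP).
apply: set_family_bounded.
exact: (assembled_bounded r0 z_ge0 c_ge0 bQ bP).
Qed.

(** With [B = b * c], each value [D (f S) rho] is at most [a * rho + B * S + d]. In the core term
    [core_scale r] enters once as scale and twice in the width, whence the factor
    [K = a + 2 * B]. *)
Lemma layered_control_linear (a b c d r : R) :
  0 < r -> 1 <= a -> 1 <= b -> 1 <= c -> 0 <= d ->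
  (forall S, 0 < S -> INR (f S) <= c * S) ->
  (forall i rho, 0 < rho -> 0 < D i rho <= a * rho + b * INR i + d) ->
  layered_control r <=
    20 * (6 * (a + 2 * b * c) ^ 2 + (a + 2 * b * c) * b * c * (INR n + 4)) * r
    + (2 * (a + 2 * b * c) + 3) * d.
Proof.
move=> r0 a1 b1 c1 d0 fS DS; have n_ge0 := pos_INR n.
have z0 : 0 < zone_bound r.
  by have := DS (f ((INR n + 10) * r)) (3 * r); rewrite /zone_bound; lra.
have DfS S rho : 0 < S -> 0 < rho -> D (f S) rho <= a * rho + b * c * S + d.
  by move=> S0 rho0; have [_] := DS (f S) rho rho0; have := fS S S0; nra.
have bc1 : 1 <= b * c by nra.
set B := b * c in DfS bc1 *.
have -> : a + 2 * b * c = a + 2 * B by rewrite /B; ring.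
set K := a + 2 * B.
have -> : K * b * c * (INR n + 4) = K * B * (INR n + 4) by rewrite /B; ring.
have zb : zone_bound r <= (3 * a + 2 + B * (INR n + 10)) * r + d.
  have := DfS ((INR n + 10) * r) (3 * r).
  by rewrite /zone_bound => H; have {H} := H _ _; nra.
have cs0 : 0 < core_scale r by rewrite /core_scale; lra.
have cb : layered_control r <=
    K * core_scale r + 3 * B * r + d + 2 * r + 2 * zone_bound r.
  have := DfS (2 * core_scale r + 3 * r) (core_scale r).
  by rewrite /layered_control /K => H; have {H} := H _ _; nra.
have K3 : a + 2 * B = K by [].
have KB : K * core_scale r <=
    K * ((6 * a + 7 + 2 * B * (INR n + 10)) * r + 2 * d).
  by apply: Rmult_le_compat_l; rewrite /core_scale; nra.
(* This compares the coefficients of [r]; those of [d] add up to [2 * K + 3]. *)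
have key : K * (6 * a + 7 + 2 * B * (INR n + 10)) + 3 * B + 2
    + 2 * (3 * a + 2 + B * (INR n + 10))
    <= 20 * (6 * K ^ 2 + K * B * (INR n + 4)).
  have BK : B <= K by lra.
  have aK : a <= K by lra.
  have K1 : 1 <= K by lra.
  have Bn0 : 0 <= B * INR n by apply: Rmult_le_pos; lra.
  have KBn : 0 <= (K - 1) * (B * INR n) by apply: Rmult_le_pos; lra.
  have KB1 : B <= K * B by nra.
  have KK : K <= K ^ 2 by nra.
  have KaK : K * a <= K ^ 2 by nra.
  by lra.
have := Rmult_le_compat_r r _ _ (Rlt_le _ _ r0) key.
lra.
Qed.

End LayeredControl.

(** * The three dimension bounds *)

Theorem theorem2p6 (n : nat) (Lc : nat -> gclass) (C : gclass) :
  (forall (i : nat) (G : wgraph), Lc i G -> Lc i.+1 G) ->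
  ((forall i : nat, asdim_le (Lc i) n) -> layerable Lc C -> asdim_le C n.+1)
  /\
  (forall a b c d : R, 1 <= a -> 1 <= b -> 1 <= c -> 0 <= d ->
     c_lin_layerable c Lc C ->
     (forall i : nat, exists Di : R -> R, control_fun_class n Di (Lc i) /\
        forall r, 0 < r -> Di r <= a * r + b * INR i + d) ->
     asdim_le_linear C n.+1 /\
     (d = 0 ->
        ANdim_le C n.+1 /\
        exists DC : R -> R, control_fun_class n.+1 DC C /\
          forall r, 0 < r ->
            DC r <= 20 * (6 * (a + 2 * b * c) ^ 2
                          + (a + 2 * b * c) * b * c * (INR n + 4)) * r)).
Proof.
have control D f : (forall i, control_fun_class n (D i) (Lc i)) ->
    layerable_with Lc C f ->
    control_fun_class n.+1 (layered_control n D f) C.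
  move=> ctrl lay G /lay [L [pL layL]]; apply: (layered_control_fun pL).
  by move=> S S0 A /(layL S S0) /ctrl.
move=> _; split=> [asdL [f lay]|a b c d a1 b1 c1 d0 [f [lay fS]] linL].
  have [D ctrl] := functional_choice asdL.
  by exists (layered_control n D f); apply: control.
(* Positivity of a control function is read off from a member of the class; for an empty class [id]
   serves, as [a >= 1]. *)
have /functional_choice [D HD] (i : nat) : exists Di : R -> R, control_fun_class n Di (Lc i) /\
    forall r, 0 < r -> 0 < Di r <= a * r + b * INR i + d.
  case: (classic (exists G, Lc i G)) => [[G LG]|no].
    have [Di [ctrl le_Di]] := linL i; exists Di; split=> // r r0.
    by split; [apply: (ctrl G LG).1 | apply: le_Di].
  exists id; split=> [G LG|r r0]; first by case: no; exists G.
  by have := pos_INR i; split=> //; nra.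
have ctrlC : control_fun_class n.+1 (layered_control n D f) C.
  by apply: control => // i; apply: (HD i).1.
have bound r (r0 : 0 < r) := layered_control_linear n r0 a1 b1 c1 d0 fS
  (fun i => (HD i).2).
set K := a + 2 * b * c in bound *; set k := 20 * _ in bound *.
have K0 : 0 <= (2 * K + 3) * d by apply: Rmult_le_pos; rewrite /K; nra.
have k0 : 0 <= k.
  have : 0 <= K * b * c * (INR n + 4).
    have := pos_INR n => ?.
    by do !(apply: Rmult_le_pos => //); rewrite /K; nra.
  by have := pow2_ge_0 K; rewrite /k; lra.
split=> [|d_eq0].
  (* A single constant must dominate both the slope and the additive term, so their sum is taken. *)
  exists (layered_control n D f), (k + (2 * K + 3) * d); split=> // r r0.
  by have := bound r r0; nra.
have bound0 r : 0 < r -> layered_control n D f r <= k * r.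
  by move=> r0; have := bound r r0; rewrite d_eq0; lra.
by split; [exists (layered_control n D f), k | exists (layered_control n D f)].
Qed.
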